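(* For each $N\ge 1$ let $U=U^{(N)}$ be a random $N\times N$ unitary matrix and $v=v^{(N)}$ a (random) unit vector in $\mathbb{C}^N$, and for $t\in(-1,1)$ let $G(t)=G_N(t)=U\,(I_N-(1-t)vv^* )$. Assume that the regularity assumption on $\mathscr{W}_2$ and the regularity assumption on $\omega_1^{(N)}$ (both stated in the context) hold. Then for any $\alpha>\epsilon>0$: (1) $G_N$ has a strongly separated outlier at the origin for $t\in\{t\in(-1,1): |t|<N^{-\frac12-\alpha}\}$. (2) With high probability, for all $t\in(-1,1)$ with $|t|>N^{-\frac12+\alpha}$, all eigenvalues of $G_N(t)$ lie in $\overline{\mathbb{D}}\setminus D(0,1-N^{-\alpha+\epsilon})$.
   Context: Notation: $\mathbb{D}$ is the open unit disk in $\mathbb{C}$, $\overline{\mathbb{D}}$ its closure, $D(z_0,r)$ the open disk of center $z_0$ and radius $r$ (empty if $r\le 0$). Eigenvalues are counted with multiplicity. A sequence of events $\Omega^{(N)}$ holds with high probability if $\mathbb{P}(\Omega^{(N)})\to1$ as $N\to\infty$; it holds with overwhelming probability if for every $A>0$, $1-\mathbb{P}(\Omega^{(N)})<N^{-A}$ for all large enough $N$. Stochastic domination: for families $X^{(N)}(z),Y^{(N)}(z)$ of complex random variables and sets $\mathscr{S}^{(N)}\subset\mathbb{D}$, ''$X\prec Y$ uniformly for $z\in\mathscr{S}^{(N)}$'' means that for every $\epsilon>0$, with overwhelming probability, $|X^{(N)}(z)|\le N^\epsilon|Y^{(N)}(z)|$ for all $z\in\mathscr{S}^{(N)}$ simultaneously.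 Define $\omega_1^{(N)}:=\sqrt N\,v^*U^*v$ and, for $z\in\mathbb{D}$, $\mathscr{W}_2(z):=v^*(zU^* )^2(I_N-zU^* )^{-1}v$. Regularity assumption on $\mathscr{W}_2$: for any $\delta>0$, $\mathscr{W}_2(z)\prec\frac{|z|^2}{\sqrt N(1-|z|)}$ uniformly for $z\in\mathbb{D}_\delta:=D(0,1-N^{-\delta})$. Regularity assumption on $\omega_1^{(N)}$: for any $\epsilon>0$, $N^{\epsilon}>|\omega_1^{(N)}|>N^{-\epsilon}$ holds with high probability. Strong separation: for $T=T_N\subset[-1,1]$ (possibly depending on $N$), $G_N$ has a strongly separated outlier towards the origin for $t\in T$ if there exist real numbers $\alpha_1<\alpha_2$ and $c_1,c_2\in(0,1)$ (independent of $N$) such that with high probability, for every $t\in T$: (i) $D\big(0,c_1\frac{N^{\alpha_1}}{1+N^{\alpha_1}}\big)$ contains exactly one eigenvalue of $G_N(t)$; (ii) $\overline{\mathbb{D}}\setminus D\big(0,c_2\frac{N^{\alpha_2}}{1+N^{\alpha_2}}\big)$ contains $N-1$ eigenvalues of $G_N(t)$. If this holds with $\alpha_1<0$, the outlier is said to be strongly separated at the origin. *)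

(* Defs.v *)
From mathcomp Require Import all_boot all_order all_algebra.
From mathcomp Require Import complex.
From mathcomp Require Import all_classical all_reals all_analysis.

Set Implicit Arguments.
Unset Strict Implicit.
Unset Printing Implicit Defensive.

Import Order.TTheory GRing.Theory Num.Theory numFieldNormedType.Exports.
Export ComplexField.Normc.

Local Open Scope classical_set_scope.
Local Open Scope ring_scope.
Local Open Scope complex_scope.
Local Open Scope sesquilinear_scope.

(* The norm of R[i] takes its values in R[i]; [normc] is the real-valued
   modulus. *)
Definition disk {R : realType} (z0 : R[i]) (r : R) : {pred R[i]} :=
  [pred z | normc (z - z0) < r].

Definition closed_annulus {R : realType} (r : R) : {pred R[i]} :=
  [pred z | (normc z <= 1) && (z \notin disk 0 r)].

(* The N eigenvalues of A, repeated according to algebraic multiplicity. *)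
Definition eigenvalues {R : realType} {N : nat} (A : 'M[R[i]]_N) : seq R[i] :=
  sval (closed_field_poly_normal (char_poly A)).

Lemma char_poly_eigenvalues {R : realType} {N : nat} (A : 'M[R[i]]_N) :
  char_poly A = \prod_(z <- eigenvalues A) ('X - z%:P).
Proof.
rewrite /eigenvalues; case: closed_field_poly_normal => s /= {1}->.
by rewrite (monicP (char_poly_monic A)) scale1r.
Qed.

Definition random_mx {d} {T : measurableType d} {R : realType} {m n : nat}
    (X : T -> 'M[R[i]]_(m, n)) : Prop :=
  forall i j, measurable_fun [set: T] (fun w => complex.Re (X w i j)) /\
              measurable_fun [set: T] (fun w => complex.Im (X w i j)).

(* Events indexed by an uncountable parameter need not be given as measurable
   sets, so their probability is read as inner probability; it agrees with P on
   measurable sets. *)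
Definition inner_prob {d} {T : measurableType d} {R : realType}
    (P : probability T R) (A : set T) : \bar R :=
  ereal_sup [set P B | B in [set B | measurable B /\ B `<=` A]].

Lemma inner_probE {d} {T : measurableType d} {R : realType}
    (P : probability T R) (A : set T) : measurable A -> inner_prob P A = P A.
Proof.
move=> mA; apply/eqP; rewrite eq_le; apply/andP; split.
  apply: ge_ereal_sup => _ [B [mB BA] <-].
  by apply: le_measure => //; rewrite inE.
by apply: ereal_sup_ubound; exists A => //; split.
Qed.

Definition with_high_probability {R : realType} {d : nat -> measure_display}
    {T : forall N, measurableType (d N)} (P : forall N, probability (T N) R)
    (E : forall N, set (T N)) : Prop :=
  (fun N => inner_prob (P N) (E N)) @ \oo --> 1%E.

Definition with_overwhelming_probability {R : realType}
    {d : nat -> measure_display} {T : forall N, measurableType (d N)}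
    (P : forall N, probability (T N) R) (E : forall N, set (T N)) : Prop :=
  forall A : R, 0 < A -> \forall N \near \oo,
    (1 - inner_prob (P N) (E N) < (N%:R `^ (- A))%:E)%E.

Definition stoch_dominated {R : realType} {d : nat -> measure_display}
    {T : forall N, measurableType (d N)} (P : forall N, probability (T N) R)
    (S : nat -> {pred R[i]}) (X Y : forall N, T N -> R[i] -> R[i]) : Prop :=
  forall eps : R, 0 < eps ->
    with_overwhelming_probability P (fun N => [set w | forall z, z \in S N ->
      normc (X N w z) <= N%:R `^ eps * normc (Y N w z)]).

Definition W2 {R : realType} {N : nat} (U : 'M[R[i]]_N) (v : 'cV[R[i]]_N)
    (z : R[i]) : R[i] :=
  (v^t* *m (z *: U^t*) ^+ 2 *m invmx (1%:M - z *: U^t*) *m v) 0 0.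

Definition omega1 {R : realType} {N : nat} (U : 'M[R[i]]_N)
    (v : 'cV[R[i]]_N) : R[i] :=
  (Num.sqrt (N%:R : R))%:C * (v^t* *m U^t* *m v) 0 0.

Definition G {R : realType} {N : nat} (U : 'M[R[i]]_N) (v : 'cV[R[i]]_N)
    (t : R) : 'M[R[i]]_N :=
  U *m (1%:M - (1 - t)%:C *: (v *m v^t*)).

Definition W2_regular {R : realType} {d : nat -> measure_display}
    {T : forall N, measurableType (d N)} (P : forall N, probability (T N) R)
    (U : forall N, T N -> 'M[R[i]]_N) (v : forall N, T N -> 'cV[R[i]]_N) : Prop :=
  forall delta : R, 0 < delta ->
    stoch_dominated P (fun N => disk 0 (1 - N%:R `^ (- delta)))
      (fun N w z => W2 (U N w) (v N w) z)
      (fun N _ z => (normc z ^+ 2 / (Num.sqrt N%:R * (1 - normc z)))%:C).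

Definition omega1_regular {R : realType} {d : nat -> measure_display}
    {T : forall N, measurableType (d N)} (P : forall N, probability (T N) R)
    (U : forall N, T N -> 'M[R[i]]_N) (v : forall N, T N -> 'cV[R[i]]_N) : Prop :=
  forall eps : R, 0 < eps ->
    with_high_probability P (fun N => [set w |
      N%:R `^ (- eps) < normc (omega1 (U N w) (v N w)) < N%:R `^ eps]).

Definition separated_with {R : realType} {d : nat -> measure_display}
    {T : forall N, measurableType (d N)} (P : forall N, probability (T N) R)
    (M : forall N, T N -> R -> 'M[R[i]]_N) (S : nat -> set R)
    (a1 a2 c1 c2 : R) : Prop :=
  with_high_probability P (fun N => [set w | forall t, S N t ->
    count (disk 0 (c1 * (N%:R `^ a1 / (1 + N%:R `^ a1))))
      (eigenvalues (M N w t)) = 1%N /\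
    count (closed_annulus (c2 * (N%:R `^ a2 / (1 + N%:R `^ a2))))
      (eigenvalues (M N w t)) = (N - 1)%N]).

Definition strongly_separated_at_origin {R : realType}
    {d : nat -> measure_display} {T : forall N, measurableType (d N)}
    (P : forall N, probability (T N) R)
    (M : forall N, T N -> R -> 'M[R[i]]_N) (S : nat -> set R) : Prop :=
  exists a1 a2 c1 c2 : R,
    [/\ a1 < a2, a1 < 0, 0 < c1 < 1, 0 < c2 < 1 &
        separated_with P M S a1 a2 c1 c2].

(* Main.v *)
(* For |z| < 1, det(z - G(t)) = det(z - U) (t - (1 - t) h(z)) with
   h(z) = z v^*U^*v + W2(z).  All roots of det(z - U) lie on the unit circle, so
   the eigenvalues of G(t) in the open disk are the roots of t = (1 - t) h(z).
   If |t| dominates 2|h| there are none.  If |t| is small, the factor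
   t - (1 - t) h(z) is within constant factors of |z v^*U^*v| on a range of
   circles.  Jensen's formula then says that prod_i max(r, |z_i|), over the
   eigenvalues z_i of G(t), is comparable to r |v^*U^*v| on that range: it grows
   too slowly in r for two eigenvalues to lie in the small disk, and it exceeds
   prod_i |z_i| = |t|, so there is at least one. *)

Require Import Defs.
From mathcomp Require Import all_boot all_order all_algebra.
From mathcomp Require Import complex.
From mathcomp Require Import all_classical all_reals all_analysis.
From mathcomp Require Import ring lra zify.

Import Order.TTheory GRing.Theory Num.Theory numFieldNormedType.Exports.

Local Open Scope classical_set_scope.
Local Open Scope ring_scope.
Local Open Scope complex_scope.
Local Open Scope sesquilinear_scope.

(** * Modulus of complex numbers *)

Lemma normc_ge0 {R : rcfType} (z : R[i]) : 0 <= normc z.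
Proof. by case: z => a b; exact: sqrtr_ge0. Qed.

Lemma normc_real {R : rcfType} (a : R) : normc a%:C = `|a|.
Proof. by rewrite /= expr0n /= addr0 sqrtr_sqr. Qed.

Lemma normcX {R : rcfType} (z : R[i]) n : normc (z ^+ n) = normc z ^+ n.
Proof. by elim: n => [|n IH]; rewrite ?expr0 ?normc1 // !exprS normcM IH. Qed.

Lemma normc_prod {R : rcfType} {I : Type} (s : seq I) (F : I -> R[i]) :
  normc (\prod_(i <- s) F i) = \prod_(i <- s) normc (F i).
Proof.
exact: (big_morph _ (fun x y => normcM x y) (normc1 R)).
Qed.

Lemma ler_dist_normc {R : rcfType} (x y : R[i]) :
  normc x - normc y <= normc (x - y).
Proof.
by rewrite lerBlDr; have := @le_normcD R (x - y) y; rewrite subrK.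
Qed.

Lemma ler_normcB {R : rcfType} (x y : R[i]) :
  normc (x - y) <= normc x + normc y.
Proof. by rewrite -[normc y](normcN y) le_normcD. Qed.

Lemma normc_distC {R : rcfType} (x y : R[i]) : normc (x - y) = normc (y - x).
Proof. by rewrite -[RHS](normcN (y - x)) opprB. Qed.

(** * Jensen products over circles *)

(** If b < a, then d (b/a)^n tends to 0 and falls below c. This is how constant factors disappear
    once powers are compared for all exponents. *)
Lemma le_of_le_geometric {R : realType} (a b c d : R) : 0 < c -> 0 <= b ->
  (forall n, c * a ^+ n.+1 <= d * b ^+ n.+1) -> a <= b.
Proof.
move=> c0 b0 H; rewrite leNgt; apply/negP => ba.
have a0 : 0 < a by apply: le_lt_trans ba.
have q1 : `|b / a| < 1.
  by rewrite ger0_norm ?ltr_pdivrMr ?mul1r // divr_ge0 // ltW.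
have cv : (fun n => d * (b / a) ^+ n) @ \oo --> (d * 0 : R).
  by apply: cvgMl_tmp; exact: cvg_expr.
rewrite mulr0 in cv.
have [n _ Hn] := cvgr_lt _ cv _ c0.
have := Hn n.+1 (leqnSn n) => /=.
rewrite expr_div_n mulrA ltr_pdivrMr ?exprn_gt0 // => /lt_le_trans => /(_ _ (H n)).
by rewrite ltxx.
Qed.

(** For r > 0 this is, by Jensen's formula, the geometric mean of |prod (y - z)| over the circle |y|
    = r, where z runs through [s]. *)
Definition jensen_prod {R : rcfType} (s : seq R[i]) (r : R) : R :=
  \prod_(z <- s) Num.max r (normc z).

Lemma normc_expB_le {R : rcfType} (r : R) (z : R[i]) n : 0 <= r ->
  normc (z ^+ n - (r ^+ n)%:C) <= 2 * Num.max r (normc z) ^+ n.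
Proof.
move=> r0; apply: le_trans (ler_normcB _ _) _.
rewrite normcX normc_real ger0_norm ?exprn_ge0 // mulr2n mulrDl mul1r.
by rewrite lerD // lerXn2r ?nnegrE ?normc_ge0 ?le_max ?lexx ?orbT ?r0.
Qed.

(** Let q < 1 be the ratio of the smaller to the larger of r and |z|; then k = 1 - q serves every
    exponent. A constant independent of n is what the limit argument needs. *)
Lemma normc_expB_ge {R : rcfType} (r : R) (z : R[i]) :
  0 < r -> normc z != r -> exists2 k, 0 < k &
    forall n, k * Num.max r (normc z) ^+ n.+1 <= normc (z ^+ n.+1 - (r ^+ n.+1)%:C).
Proof.
move=> r0; set x := normc z => xr.
have x0 : 0 <= x by exact: normc_ge0.
have key : forall a b : R, 0 <= a -> a < b -> forall n,
    (1 - a / b) * b ^+ n.+1 <= b ^+ n.+1 - a ^+ n.+1.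
  move=> a b a0 ab n; have b0 : 0 < b by apply: le_lt_trans ab.
  rewrite mulrBl mul1r lerB //.
  have -> : a / b * b ^+ n.+1 = a * b ^+ n by rewrite exprS mulrA divfK ?gt_eqF.
  by rewrite exprS ler_wpM2l // lerXn2r ?nnegrE // ltW.
have nn n : 0 <= r ^+ n.+1 by rewrite exprn_ge0 // ltW.
case: (ltgtP x r) xr => // xr _.
- exists (1 - x / r); first by rewrite subr_gt0 ltr_pdivrMr ?mul1r.
  move=> n; apply: le_trans (key _ _ x0 xr n) _; rewrite normc_distC.
  by apply: le_trans (ler_dist_normc _ _); rewrite normc_real ger0_norm // normcX.
- exists (1 - r / x); first by rewrite subr_gt0 ltr_pdivrMr ?mul1r // (lt_trans r0).
  move=> n; apply: le_trans (key _ _ (ltW r0) xr n) _.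
  by apply: le_trans (ler_dist_normc _ _); rewrite normc_real ger0_norm // normcX.
Qed.

Lemma prod_normc_expB_le {R : rcfType} (r : R) (s : seq R[i]) n : 0 <= r ->
  \prod_(z <- s) normc (z ^+ n - (r ^+ n)%:C) <=
    2 ^+ size s * jensen_prod s r ^+ n.
Proof.
move=> r0; rewrite /jensen_prod; elim: s => [|z s IH].
  by rewrite !big_nil expr1n mulr1.
rewrite !big_cons /= exprS exprMn mulrACA.
rewrite ler_pM ?normc_ge0 ?normc_expB_le //.
by apply: prodr_ge0 => y _; exact: normc_ge0.
Qed.

Lemma prod_normc_expB_ge {R : rcfType} (r : R) (s : seq R[i]) :
  0 < r -> {in s, forall z, normc z != r} -> exists2 k, 0 < k & forall n,
    k * jensen_prod s r ^+ n.+1 <=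
      \prod_(z <- s) normc (z ^+ n.+1 - (r ^+ n.+1)%:C).
Proof.
move=> r0; rewrite /jensen_prod; elim: s => [|z s IH] hs.
  by exists 1 => // n; rewrite !big_nil expr1n mulr1.
have [k k0 hk] := normc_expB_ge _ _ r0 (hs z (mem_head _ _)).
have [|k' k'0 hk'] := IH; first by move=> y ys; apply: hs; rewrite inE ys orbT.
exists (k * k'); first exact: mulr_gt0.
move=> n; rewrite !big_cons exprMn mulrACA ler_pM //.
- by rewrite mulr_ge0 ?exprn_ge0 ?le_max ?normc_ge0 ?orbT // ltW.
- rewrite mulr_ge0 ?exprn_ge0 // ?ltW //.
  by apply: prodr_gt0 => y _; rewrite lt_max r0.
Qed.

(** The nodes are the roots of X^(n+1) - r^(n+1); the shifted exponent keeps the degree positive. *)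
Lemma circle_nodes {R : rcfType} (r : R) n : 0 <= r -> exists s : seq R[i],
  [/\ size s = n.+1, {in s, forall y, normc y = r} &
    forall z, \prod_(y <- s) normc (y - z) =
      normc (z ^+ n.+1 - (r ^+ n.+1)%:C)].
Proof.
move=> r0; set c := (r ^+ n.+1)%:C.
have [s] := closed_field_poly_normal ('X^(n.+1) - c%:P).
rewrite lead_coefXnsubC // scale1r => E; exists s; split.
- have := congr1 (fun p : {poly R[i]} => size p) E.
  by rewrite /= size_XnsubC // size_prod_XsubC => -[].
- move=> y ys; have : root ('X^(n.+1) - c%:P) y by rewrite E root_prod_XsubC.
  rewrite /root !hornerE subr_eq0 => /eqP /(congr1 (@normc R)).
  rewrite normcX normc_real ger0_norm ?exprn_ge0 // => /eqP.
  by rewrite eqrXn2 ?normc_ge0 // => /eqP.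
- move=> z; have := congr1 (fun p : {poly R[i]} => normc p.[z]) E.
  rewrite /= horner_prod !hornerE => ->; rewrite normc_prod.
  by apply: eq_bigr => y _; rewrite !hornerE normc_distC.
Qed.

(* Jensen's formula without logarithms: comparing the products of |p| and |q|
   over the n-th roots of r^n and letting n tend to infinity compares the
   geometric means of |p| and |q| over the circle. *)
Lemma jensen_prod_le {R : realType} (a r : R) (s u : seq R[i]) :
  0 <= a -> 0 < r -> {in u, forall z, normc z != r} ->
  (forall y, normc y = r -> a * normc (\prod_(z <- u) (y - z)) <=
                           normc (\prod_(z <- s) (y - z))) ->
  a * jensen_prod u r <= jensen_prod s r.
Proof.
move=> a0 r0 ur H.
have [k k0 hk] := prod_normc_expB_ge _ _ r0 ur.
have J0 t : 0 <= jensen_prod t r.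
  by apply: prodr_ge0 => z _; rewrite le_max normc_ge0 orbT.
apply: (@le_of_le_geometric _ _ _ k (2 ^+ size s)) => // n.
apply: le_trans (prod_normc_expB_le _ _ _ (ltW r0)).
have [nodes [sz nr E]] := circle_nodes _ n (ltW r0).
rewrite exprMn mulrCA; apply: le_trans (ler_wpM2l (exprn_ge0 _ a0) (hk n)) _.
under eq_bigr do rewrite -E; under [leRHS]eq_bigr do rewrite -E.
(* With the product over the nodes outermost, the hypothesis on the circle applies factor by
   factor. *)
rewrite exchange_big [leRHS]exchange_big /=.
have -> : a ^+ n.+1 = \prod_(y <- nodes) a.
  by rewrite big_const_seq count_predT sz iter_mulr_1.
rewrite -big_split /= big_seq [leRHS]big_seq; apply: ler_prod => y yn.
rewrite -!normc_prod mulr_ge0 ?normc_ge0 //=.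
exact/H/nr.
Qed.

(** * Counting roots in a disk by Jensen products *)

(** Supplies a radius avoiding the moduli of finitely many roots, so that the Jensen comparison
    applies on that circle. *)
Lemma ex_between_notin {R : realFieldType} (s : seq R) (a b : R) :
  a < b -> exists2 c, a < c < b & c \notin s.
Proof.
move=> ab.
(* Strengthened for the induction: no element of [s] lies in (a, c], a property that survives
   decreasing c. *)
suff [c cab H] : exists2 c, a < c < b & {in s, forall x, ~~ (a < x <= c)}.
  exists c => //; apply/negP => /H; rewrite lexx andbT.
  by case/andP: cab => ->.
elim: s => [|x s [c cab IH]].
  by exists ((a + b) / 2) => //; lra.
have [/andP[ax xc]|xac] := boolP (a < x <= c).
- exists ((a + x) / 2) => [|y]; first lra.
  rewrite inE => /predU1P[->|/IH]; first by rewrite ax /= -ltNge; lra.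
  by apply: contra => /andP[-> /= ?]; lra.
- by exists c => // y; rewrite inE => /predU1P[->//|/IH].
Qed.

Lemma disk0E {R : realType} (r : R) (z : R[i]) : disk 0 r z = (normc z < r).
Proof. by rewrite -[disk 0 r z]/(normc (z - 0) < r) subr0. Qed.

(** Raising the radius from r to r' multiplies the factor of each root in the small disk by r'/r and
    decreases no other factor. *)
Lemma jensen_prod_disk {R : realType} (s : seq R[i]) (r r' : R) :
  0 < r -> r <= r' ->
  (r' / r) ^+ count (disk 0 r) s * jensen_prod s r <= jensen_prod s r'.
Proof.
move=> r0 rr; have r'0 : 0 < r' by apply: lt_le_trans rr.
rewrite /jensen_prod; elim: s => [|z s IH]; first by rewrite !big_nil mulr1.
rewrite !big_cons /= exprD mulrACA ler_pM //.
- by rewrite mulr_ge0 ?exprn_ge0 ?divr_ge0 ?le_max ?(ltW r0) ?(ltW r'0).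
- rewrite mulr_ge0 ?exprn_ge0 ?divr_ge0 ?(ltW r0) ?(ltW r'0) //.
  by apply: prodr_ge0 => y _; rewrite le_max (ltW r0).
- rewrite disk0E; case: ltP => zr.
  + by rewrite expr1 divfK ?gt_eqF // le_max lexx.
  + by rewrite expr0 mul1r le_max lexx orbT.
Qed.

Lemma jensen_prod_unit {R : realType} (u : seq R[i]) (r : R) :
  {in u, forall z, normc z = 1} -> r <= 1 -> jensen_prod u r = 1.
Proof.
move=> u1 r1; rewrite /jensen_prod big_seq big1 // => z /u1 ->.
by rewrite max_r.
Qed.

(** Without a root in the disk every maximum in the Jensen product of [s] is |z|, so prod |z| equals
    that product, which is at least a because the Jensen product of [u] is 1. *)
Lemma has_root_disk {R : realType} (s u : seq R[i]) (a r : R) :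
  {in u, forall z, normc z = 1} -> 0 < r < 1 -> 0 <= a ->
  (forall y, normc y = r -> a * normc (\prod_(z <- u) (y - z)) <=
                           normc (\prod_(z <- s) (y - z))) ->
  \prod_(z <- s) normc z < a -> (0 < count (disk 0%R r) s)%N.
Proof.
move=> u1 /andP[r0 r1] a0 H; apply: contraLR.
rewrite -leqNgt leqn0 -leNgt eqn0Ngt -has_count -all_predC => /allP sr.
have -> : \prod_(z <- s) normc z = jensen_prod s r.
  rewrite /jensen_prod big_seq [RHS]big_seq; apply: eq_bigr => z /sr.
  by rewrite [X in X -> _]/= disk0E -leNgt => /max_r ->.
rewrite -[a]mulr1 -(jensen_prod_unit u r) //; last exact: ltW.
apply: jensen_prod_le => // z /u1 ->; by rewrite gt_eqF.
Qed.

(** On the circles considered the quotient of the two polynomials grows linearly in |y| up to a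
    factor 4, whereas two roots in the disk would force quadratic growth. *)
Lemma count_root_disk_le1 {R : realType} (s u : seq R[i]) (k r : R) :
  {in u, forall z, normc z = 1} -> 0 < r -> 16 * r < 1 -> 0 < k ->
  (forall y, r <= normc y <= 16 * r ->
    k * normc y / 2 * normc (\prod_(z <- u) (y - z)) <=
      normc (\prod_(z <- s) (y - z)) <=
    2 * k * normc y * normc (\prod_(z <- u) (y - z))) ->
  (count (disk 0%R r) s <= 1)%N.
Proof.
move=> u1 r0 r1 k0 H; rewrite leqNgt; apply/negP => c2.
(* For the upper bound [s] is on the smaller side of the comparison, so its moduli must avoid the
   radius. *)
have [r' r'r /= r's] : exists2 c, 8 * r < c < 16 * r & c \notin map (@normc R) s.
  by apply: ex_between_notin; lra.
have {r'r}[r'8 r'16] := andP r'r.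
have r'0 : 0 < r' by lra.
have ju x : x <= 1 -> jensen_prod u x = 1 by exact: jensen_prod_unit.
have lo : k * r / 2 <= jensen_prod s r.
  suff: k * r / 2 * jensen_prod u r <= jensen_prod s r by rewrite ju ?mulr1 //; lra.
  apply: jensen_prod_le => //; first by rewrite !(divr_ge0, mulr_ge0) // ltW.
    by move=> z /u1 ->; rewrite gt_eqF //; lra.
  by move=> y yr; have := H y; rewrite yr => /(_ _)/andP[]; lra.
have hi : jensen_prod s r' <= 2 * k * r'.
  have q0 : 0 < 2 * k * r' by rewrite !mulr_gt0.
  suff: (2 * k * r')^-1 * jensen_prod s r' <= jensen_prod u r'.
    by rewrite ju; [rewrite ler_pdivrMl // mulr1 | lra].
  apply: jensen_prod_le => //; first by rewrite invr_ge0 ltW.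
    by move=> z zs; apply: contra r's => /eqP <-; exact: map_f.
  move=> y yr; rewrite ler_pdivrMl //.
  by have := H y; rewrite yr => /(_ _)/andP[]; lra.
have rr' : 8 <= r' / r by rewrite ler_pdivlMr // ltW.
(* After cancellation this reads r'/r <= 4, against r'/r >= 8. *)
have : (r' / r) ^+ 2 * (k * r / 2) <= 2 * k * r'.
  apply: le_trans hi; apply: le_trans (jensen_prod_disk s _ _ r0 _); last lra.
  apply: ler_pM => //; first by rewrite exprn_ge0 //; lra.
    by rewrite !(divr_ge0, mulr_ge0) // ltW.
  by rewrite ler_weXn2l //; lra.
have -> : (r' / r) ^+ 2 * (k * r / 2) = (r' / r / 2) * (k * r').
  by field; rewrite gt_eqF.
rewrite -[leRHS]mulrA ler_pM2r ?mulr_gt0 //; lra.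
Qed.

(** * Modulus bounds for the eigenvalues of U and G(t) *)

Lemma normcE {R : rcfType} (z : R[i]) : `|z| = (normc z)%:C.
Proof. by case: z. Qed.

Lemma dotmx_mulmx {C : numClosedFieldType} m n (x : 'rV[C]_m) (A : 'M[C]_(m, n)) :
  dotmx (x *m A) (x *m A) = (x *m (A *m A^t*) *m x^t*) 0 0.
Proof. by rewrite dotmxE trmx_mul map_mxM !mulmxA. Qed.

Lemma dotmx_unitary {C : numClosedFieldType} n (x : 'rV[C]_n) (U : 'M[C]_n) :
  U \is unitarymx -> dotmx (x *m U) (x *m U) = dotmx x x.
Proof. by move=> /unitarymxP uU; rewrite dotmx_mulmx uU mulmx1 dotmxE. Qed.

Lemma normc_eigenvalue_unitary {R : realType} n (U : 'M[R[i]]_n) z :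
  U \is unitarymx -> eigenvalue U z -> normc z = 1.
Proof.
move=> uU /eigenvalueP[x xU x0]; have xx := dotmx_is_dotmx x0.
have := dotmx_unitary _ x U uU; rewrite xU dnormZ -[RHS]mul1r.
have /mulIf H : dotmx x x != 0 by rewrite gt_eqF.
move=> /H; rewrite normcE -rmorphXn /= => /complexI/eqP.
by rewrite sqrf_eq1 => /orP[/eqP//|/eqP h]; have := normc_ge0 z; rewrite h; lra.
Qed.

(** G(t) is U times a contraction B: for a row vector x, |x U B|^2 = |x|^2 - (1 - t^2) |x U v|^2. *)
Lemma normc_eigenvalue_G {R : realType} n (U : 'M[R[i]]_n) (v : 'cV[R[i]]_n) t z :
  U \is unitarymx -> (v^t* *m v) 0 0 = 1 -> `|t| <= 1 ->
  eigenvalue (G U v t) z -> normc z <= 1.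
Proof.
move=> uU v1 t1 /eigenvalueP[x xG x0]; have xx := dotmx_is_dotmx x0.
set B := 1%:M - (1 - t)%:C *: (v *m v^t*).
(* Since v v^* is a projection, squaring 1 - s v v^* with s = 1 - t gives the coefficient 2s - s^2 =
   1 - t^2. *)
have BB : B *m B^t* = 1%:M - (1 - t ^+ 2)%:C *: (v *m v^t*).
  have -> : B^t* = B.
    rewrite /B linearB /= linearZ /= map_mxB map_mxZ trmx_mul map_mxM trmx1 map_mx1.
    rewrite trmxCK; congr (_ - _ *: _).
    exact: conjc_real.
  have vv : v^t* *m v = 1%:M by apply/matrixP=> i j; rewrite !ord1 v1 mxE.
  rewrite /B mulmxBl mul1mx mulmxBr mulmx1 -scalemxAl -scalemxAr mulmxA.
  rewrite -[v *m _ *m v]mulmxA vv mulmx1 scalerA.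
  rewrite -addrA -opprD; congr (_ - _); rewrite addrA -scalerDl -scalerBl.
  by congr (_ *: _); rewrite -rmorphM -rmorphD -rmorphB; congr _%:C; ring.
set y := x *m U; have xGy : x *m G U v t = y *m B by rewrite mulmxA.
have : dotmx (x *m G U v t) (x *m G U v t) <= dotmx x x.
  rewrite xGy dotmx_mulmx BB mulmxBr mulmxBl mulmx1 mxE -dotmxE dotmx_unitary //.
  rewrite gerDl mxE oppr_le0 -scalemxAr -scalemxAl mxE.
  have -> : y *m (v *m v^t*) *m y^t* = (y *m v) *m (y *m v)^t*.
    by rewrite (trmx_mul y) map_mxM !mulmxA.
  rewrite mulr_ge0 //; last by rewrite mxE big_ord1 !mxE -normCK exprn_ge0.
  rewrite -[0]/(0%:C) lecR subr_ge0 -(expr1n _ 2) -real_normK ?num_real //.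
  by rewrite lerXn2r ?nnegrE.
rewrite xG dnormZ -[leRHS]mul1r ler_pM2r // -(expr1n _ 2).
rewrite ler_pXn2r ?nnegrE // normcE.
by rewrite -[1]/(1%:C) lecR.
Qed.

(** * The characteristic polynomial of a rank-one perturbation *)

(** The matrix determinant lemma, from the two block triangular factorizations of M. *)
Lemma det_add1_mul {K : comNzRingType} n (a : 'cV[K]_n) (b : 'rV[K]_n) :
  \det (1%:M + a *m b) = 1 + (b *m a) 0 0.
Proof.
pose M := block_mx (1%:M : 'M[K]_1) (- b) a 1%:M.
have E1 : M = block_mx 1%:M 0 a 1%:M *m block_mx 1%:M (- b) 0 (1%:M + a *m b).
  rewrite mulmx_block !(mul1mx, mul0mx, mulmx1, mulmx0, addr0, add0r).
  by rewrite mulmxN addrCA addNr addr0.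
have E2 : M = block_mx (1%:M + b *m a) (- b) 0 1%:M *m block_mx 1%:M 0 a 1%:M.
  rewrite mulmx_block !(mul1mx, mul0mx, mulmx1, mulmx0, addr0, add0r).
  by rewrite mulNmx addrK.
have := congr1 determinant E1; rewrite {1}E2 !det_mulmx !det_ublock !det_lblock.
by rewrite !det1 !mul1r !mulr1 det_mx11 !mxE => <-.
Qed.

Lemma horner_char_poly {K : comNzRingType} n (A : 'M[K]_n) z :
  (char_poly A).[z] = \det (z%:M - A).
Proof.
rewrite -horner_evalE -det_map_mx; congr determinant; apply/matrixP=> i j.
by rewrite !mxE /= horner_evalE !hornerE hornerMn hornerX.
Qed.

(** Factoring z - U out of z - G(t) leaves a rank-one perturbation of the identity, with determinant
    1 - (1 - t) v^* K^-1 v. *)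
Lemma char_poly_G {R : realType} n (U : 'M[R[i]]_n) (v : 'cV[R[i]]_n) t z :
  U \is unitarymx -> (v^t* *m v) 0 0 = 1 -> normc z < 1 ->
  (char_poly (G U v t)).[z] = (char_poly U).[z] *
    (t%:C - (1 - t)%:C * (z * (v^t* *m U^t* *m v) 0 0 + W2 U v z)).
Proof.
move=> uU v1 z1; set A := z *: U^t*; set K := 1%:M - A.
have EU : z%:M - U = - U *m K.
  rewrite /K /A mulmxBr mulmx1 -scalemxAr mulNmx (elimT unitarymxP uU).
  by rewrite scalerN opprK scalemx1 addrC.
(* A point of the open disk is not an eigenvalue of U. *)
have uK : K \in unitmx.
  have : z%:M - U \in unitmx.
    rewrite unitmxE unitfE -horner_char_poly -[_ == _]/(root _ z).
    rewrite -eigenvalue_root_char; apply/negP => /(normc_eigenvalue_unitary _ _ _ uU) h.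
    by rewrite h ltxx in z1.
  by rewrite EU unitmx_mul => /andP[].
have EG : z%:M - G U v t = (z%:M - U) *m (1%:M + (- (1 - t)%:C *: (invmx K *m v)) *m v^t*).
  rewrite mulmxDr mulmx1 {2}EU !(scaleNr, mulNmx, mulmxN, opprK).
  rewrite -scalemxAl -scalemxAr !mulmxA mulmxK //.
  by rewrite /G mulmxBr mulmx1 -scalemxAr mulmxA opprB addrA addrAC.
(* Neumann expansion to second order with exact remainder: its terms yield v^* v = 1, z v^* U^* v
   and [W2]. *)
have EK : invmx K = 1%:M + A + A ^+ 2 *m invmx K.
  have : (1%:M + A) *m K = 1%:M - A ^+ 2.
    by rewrite /K mulmxBr mulmx1 mulmxDl mul1mx opprD addrA addrK expr2.
  move=> /(congr1 (fun X => X *m invmx K)); rewrite mulmxK // mulmxBl mul1mx.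
  by move=> ->; rewrite subrK.
rewrite !horner_char_poly EG det_mulmx det_add1_mul; congr (_ * _).
rewrite -scalemxAr mxE mulmxA {1}EK /W2 -/A -/K.
have -> : v^t* *m (1%:M + A + A ^+ 2 *m invmx K) *m v =
    v^t* *m v + z *: (v^t* *m U^t* *m v) + v^t* *m A ^+ 2 *m invmx K *m v.
  by rewrite !mulmxDr !mulmxDl mulmx1 -scalemxAr -scalemxAl mulmxA.
have mxD (X Y : 'M[R[i]]_1) : (X + Y) 0 0 = X 0 0 + Y 0 0 by rewrite mxE.
have mxZ (X : 'M[R[i]]_1) : (z *: X) 0 0 = z * X 0 0 by rewrite mxE.
rewrite !mxD mxZ v1 rmorphB rmorph1; ring.
Qed.

(** * Deterministic location of the eigenvalues of G(t) *)

Lemma closed_annulusE {R : realType} (r : R) z :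
  (z \in closed_annulus r) = (r <= normc z <= 1).
Proof. by rewrite inE -[z \in disk 0 r]/(disk 0 r z) disk0E -leNgt andbC. Qed.

Lemma mem_eigenvalues {R : realType} n (A : 'M[R[i]]_n) z :
  (z \in eigenvalues A) = eigenvalue A z.
Proof. by rewrite eigenvalue_root_char char_poly_eigenvalues root_prod_XsubC. Qed.

Lemma size_eigenvalues {R : realType} n (A : 'M[R[i]]_n) : size (eigenvalues A) = n.
Proof.
have := size_char_poly A.
by rewrite char_poly_eigenvalues size_prod_XsubC => -[].
Qed.

Lemma prod_eigenvalues {R : realType} n (A : 'M[R[i]]_n) y :
  \prod_(z <- eigenvalues A) (y - z) = (char_poly A).[y].
Proof.
rewrite char_poly_eigenvalues horner_prod.
by apply: eq_bigr => z _; rewrite !hornerE.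
Qed.

Lemma W2_0 {R : realType} n (U : 'M[R[i]]_n) (v : 'cV[R[i]]_n) : W2 U v 0 = 0.
Proof. by rewrite /W2 scale0r expr0n /= !(mulmx0, mul0mx) mxE. Qed.

Section Eigenvalues_G.
Context {R : realType} {n : nat} (U : 'M[R[i]]_n) (v : 'cV[R[i]]_n) (t : R).
Context (uU : U \is unitarymx) (v1 : (v^t* *m v) 0 0 = 1).

Let k := normc ((v^t* *m U^t* *m v) 0 0).

Lemma eigenvalue_G_annulus (r : R) z : `|t| <= 1 -> r <= 1 ->
  (forall y, normc y < r -> `|1 - t| * (normc y * k + normc (W2 U v y)) < `|t|) ->
  eigenvalue (G U v t) z -> z \in closed_annulus r.
Proof.
move=> t1 r1 H zG; rewrite closed_annulusE (normc_eigenvalue_G _ _ _ _ _ uU v1 t1 zG) andbT.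
rewrite leNgt; apply/negP => zr.
have z1 : normc z < 1 by apply: lt_le_trans r1.
move: zG; rewrite eigenvalue_root_char /root char_poly_G // mulf_eq0 => /orP[qz|].
  have : eigenvalue U z by rewrite eigenvalue_root_char.
  by move=> /(normc_eigenvalue_unitary _ _ _ uU) h; rewrite h ltxx in z1.
rewrite subr_eq0 => /eqP/(congr1 (@normc R)); rewrite normcM !normc_real => E.
have := H z zr; rewrite E ltNge ler_wpM2l //.
by apply: le_trans (le_normcD _ _) _; rewrite normcM.
Qed.

(** The hypotheses make k |y| the dominant size of t - (1 - t) h(y) for r1 <= |y| <= 16 r2.
    Existence is proved at radius r1, uniqueness at r2. *)
Lemma count_eigenvalues_G (r1 r2 : R) : 0 < k -> 0 < r1 -> r1 <= r2 ->
  16 * r2 < 1 -> `|t| <= 1 / 8 -> `|t| <= k * r1 / 8 ->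
  (forall y, r1 <= normc y <= 16 * r2 -> normc (W2 U v y) <= k * normc y / 8) ->
  count (disk 0 r1) (eigenvalues (G U v t)) = 1%N /\
  count (closed_annulus r2) (eigenvalues (G U v t)) = (n - 1)%N.
Proof.
move=> k0 r10 r12 r21 t8 tr1 HW; set s := eigenvalues _.
have u1 : {in eigenvalues U, forall z, normc z = 1}.
  by move=> z; rewrite mem_eigenvalues; exact: normc_eigenvalue_unitary.
have s1 : {in s, forall z, normc z <= 1}.
  move=> z; rewrite mem_eigenvalues; apply: normc_eigenvalue_G => //; lra.
have pq y : normc y < 1 -> normc (\prod_(z <- s) (y - z)) =
    normc (\prod_(z <- eigenvalues U) (y - z)) *
    normc (t%:C - (1 - t)%:C * (y * (v^t* *m U^t* *m v) 0 0 + W2 U v y)).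
  by move=> y1; rewrite !prod_eigenvalues char_poly_G // normcM.
have bound y : r1 <= normc y <= 16 * r2 ->
    k * normc y / 2 * normc (\prod_(z <- eigenvalues U) (y - z)) <=
      normc (\prod_(z <- s) (y - z)) <=
    2 * k * normc y * normc (\prod_(z <- eigenvalues U) (y - z)).
  move=> yr; have {}HW := HW y yr; case/andP: yr => yr1 yr2.
  rewrite pq; last lra.
  rewrite ![_ * normc (\prod_(z <- eigenvalues U) _)]mulrC.
  suff /andP[lo hi] : k * normc y / 2 <= normc (t%:C - (1 - t)%:C *
    (y * (v^t* *m U^t* *m v) 0 0 + W2 U v y)) <= 2 * k * normc y.
    by rewrite !ler_wpM2l ?normc_ge0.
  set c := y * _; have cE : normc c = normc y * k by rewrite normcM.
  have a0 : 0 <= k * normc y by rewrite mulr_ge0 ?normc_ge0 // ltW.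
  have ta : `|t| <= k * normc y / 8.
    by apply: le_trans tr1 _; rewrite ler_pM2r // ler_pM2l.
  have h1 : normc (c + W2 U v y) <= 9 / 8 * (k * normc y).
    by apply: le_trans (le_normcD _ _) _; rewrite cE; lra.
  have h2 : 7 / 8 * (k * normc y) <= normc (c + W2 U v y).
    have := ler_dist_normc c (- W2 U v y).
    by rewrite opprK [normc (- _)]normcN cE; lra.
  have [t1 t2] : 7 / 8 <= `|1 - t| /\ `|1 - t| <= 9 / 8.
    by have := t8; rewrite ler_norml => /andP[? ?]; rewrite ger0_norm; lra.
  have f1 : `|1 - t| * normc (c + W2 U v y) <= 9 / 8 * (9 / 8 * (k * normc y)).
    by rewrite ler_pM ?normc_ge0.
  have f2 : 7 / 8 * (7 / 8 * (k * normc y)) <= `|1 - t| * normc (c + W2 U v y).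
    by rewrite ler_pM ?mulr_ge0 ?normc_ge0 // ltW.
  (* With |t| at most 1/8 of k |y|, the modulus lies between 49/64 - 8/64 and 81/64 + 8/64 times k
     |y|, hence between 1/2 and 2 times it. *)
  have := ler_normcB t%:C ((1 - t)%:C * (c + W2 U v y)).
  have := ler_dist_normc ((1 - t)%:C * (c + W2 U v y)) t%:C.
  rewrite [normc (_ * _ - _)]normc_distC normcM !normc_real.
  by move=> g1 g2; apply/andP; split; lra.
have c1 : (0 < count (disk 0%R r1) s)%N.
  apply: (has_root_disk _ (eigenvalues U) (k * r1 / 2)) => //.
  - lra.
  - by rewrite !(divr_ge0, mulr_ge0) // ltW.
  - by move=> y yr; have := bound y; rewrite yr => /(_ _)/andP[]; lra.
  (* Evaluation at y = 0 shows that the product of the moduli is |t|, which is at most k r1 / 8 and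
     so below k r1 / 2. *)
  - have -> : \prod_(z <- s) normc z = normc (\prod_(z <- s) (0 - z)).
      by rewrite normc_prod; apply: eq_bigr => z _; rewrite normc_distC subr0.
    rewrite pq ?normc0 // mul0r add0r W2_0 mulr0 subr0 normc_real normc_prod.
    rewrite big_seq big1 ?mul1r => [|z /u1]; last by rewrite normc_distC subr0.
    by apply: le_lt_trans tr1 _; have := mulr_gt0 k0 r10; lra.
have c2 : (count (disk 0%R r2) s <= 1)%N.
  apply: (count_root_disk_le1 _ (eigenvalues U) k) => //; first lra.
  by move=> y yr; apply: bound; lra.
have c12 : (count (disk 0%R r1) s <= count (disk 0%R r2) s)%N.
  by apply: sub_count => z; rewrite !disk0E => /lt_le_trans; apply.
split; first by lia.
(* All eigenvalues lie in the closed unit disk, so the annulus and the complement of the disk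
   contain the same ones. *)
have -> : count (closed_annulus r2) s = count (predC (disk 0 r2)) s.
  apply: eq_in_count => z zs.
  rewrite -[LHS]/(z \in closed_annulus r2) closed_annulusE s1 // andbT.
  by rewrite [RHS]/= disk0E -leNgt.
have := count_predC (disk 0 r2) s; rewrite size_eigenvalues; lia.
Qed.
End Eigenvalues_G.

(** * Inner probability and events of high probability *)

Lemma near_powRN_lt {R : realType} (a e : R) : 0 < a -> 0 < e ->
  \forall N \near \oo, (N%:R : R) `^ (- a) < e.
Proof.
move=> a0 e0; near=> N.
have h : e^-1 `^ a^-1 < N%:R by near: N; exact: nbhs_infty_gtr.
rewrite powRN invf_plt ?posrE ?powR_gt0 //; last first.
  by apply: le_lt_trans h; exact: powR_ge0.
have := gt0_ltr_powR a0 _ _ h; rewrite !nnegrE powR_ge0 ler0n => /(_ isT isT).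
by rewrite -powRrM mulVf ?gt_eqF // powRr1 // invr_ge0 ltW.
Unshelve. all: by end_near. Qed.

Section InnerProb.
Context {d} {T : measurableType d} {R : realType} (P : probability T R).
Local Open Scope ereal_scope.

Lemma inner_prob_ge0 (A : set T) : 0 <= inner_prob P A.
Proof.
by apply: ereal_sup_ubound; exists set0; [split => // | rewrite measure0].
Qed.

Lemma inner_prob_le1 (A : set T) : inner_prob P A <= 1.
Proof. by apply: ge_ereal_sup => _ [B [mB _] <-]; exact: probability_le1. Qed.

Lemma inner_prob_fin_num (A : set T) : inner_prob P A \is a fin_num.
Proof.
by rewrite ge0_fin_numE ?inner_prob_ge0 // (le_lt_trans (inner_prob_le1 A)) ?ltry.
Qed.

Lemma le_inner_prob (A B : set T) : A `<=` B -> inner_prob P A <= inner_prob P B.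
Proof.
move=> AB; apply: ge_ereal_sup => _ [X [mX XA] <-].
by apply: ereal_sup_ubound; exists X => //; split=> //; exact: subset_trans AB.
Qed.

(** For measurable X in A and Y in B, P(X) = P(X \ Y) + P(X & Y) <= 1 - P(Y) + P(X & Y); the suprema
    over X and Y are taken one after the other. *)
Lemma inner_probI (A B : set T) :
  inner_prob P A + inner_prob P B <= 1 + inner_prob P (A `&` B).
Proof.
rewrite -leeBrDr ?inner_prob_fin_num //.
apply: ge_ereal_sup => _ [X [mX XA] <-].
have fX : P X \is a fin_num by exact: fin_num_measure.
rewrite leeBrDr ?inner_prob_fin_num // addeC -leeBrDr //.
apply: ge_ereal_sup => _ [Y [mY YB] <-].
rewrite leeBrDr // addeC.
have XY : P (X `&` Y) <= inner_prob P (A `&` B).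
  apply: ereal_sup_ubound; exists (X `&` Y) => //; split; first exact: measurableI.
  exact: setISS.
apply: le_trans (leeD2l _ XY).
rewrite (measureDI P mX mY) -addeA.
have XD : P (X `\` Y) <= 1 - P Y.
  rewrite -probability_setC //; apply: le_measure; rewrite ?inE.
  - exact: measurableD.
  - exact: measurableC.
  - by move=> x [].
by rewrite [P (X `&` Y) + _]addeC addeA leeD2r // -leeBrDr ?fin_num_measure.
Qed.
End InnerProb.

Section HighProbability.
Context {R : realType} {d : nat -> measure_display}
  {T : forall N, measurableType (d N)} (P : forall N, probability (T N) R).

Lemma with_high_probability_overwhelming (E : forall N, set (T N)) :
  with_overwhelming_probability P E -> with_high_probability P E.
Proof.
move=> /(_ 1 ltr01) H.
have cv : (fun N => (1 - (N%:R : R) `^ (- 1))%:E) @ \oo --> 1%E.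
  apply: cvg_EFin; first exact: nearW.
  rewrite -[1 in X in _ --> X]subr0; apply: cvgB; first exact: cvg_cst.
  apply/cvgrPdist_lt => e e0; near=> N.
  rewrite sub0r normrN ger0_norm ?powR_ge0 //.
  by near: N; exact: near_powRN_lt.
apply: squeeze_cvge cv (cvg_cst _); near=> N.
rewrite inner_prob_le1 andbT EFinB leeBlDr // -leeBlDl ?inner_prob_fin_num //.
by apply: ltW; near: N.
Unshelve. all: by end_near. Qed.

(** The inclusion is asked for large N only, since the deterministic estimates need negative powers
    of N to be small. *)
Lemma with_high_probabilityI (A B C : forall N, set (T N)) :
  (\forall N \near \oo, A N `&` B N `<=` C N) ->
  with_high_probability P A -> with_high_probability P B ->
  with_high_probability P C.
Proof.
move=> ABC hA hB.
have hAB : (fun N => inner_prob (P N) (A N) + inner_prob (P N) (B N) - 1)%E @ \oo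
    --> 1%E.
  have e : (1 + 1 - 1)%E = 1%E :> \bar R by rewrite addeK.
  by apply: cvg_trans (cvgeB _ (cvgeD _ hA hB) (cvg_cst 1%E)) _; rewrite ?e.
apply: squeeze_cvge hAB (cvg_cst _); near=> N.
rewrite inner_prob_le1 andbT leeBlDr // [leRHS]addeC.
apply: le_trans (inner_probI _ _ _) _; rewrite leeD2l // le_inner_prob //.
by near: N.
Unshelve. all: by end_near. Qed.
End HighProbability.

(** * Deterministic estimates at the rates of the theorem *)

Lemma normc_omega1 {R : realType} N (U : 'M[R[i]]_N) (v : 'cV[R[i]]_N) :
  normc (omega1 U v) = Num.sqrt N%:R * normc ((v^t* *m U^t* *m v) 0 0).
Proof. by rewrite normcM normc_real ger0_norm // sqrtr_ge0. Qed.

(* Applied with x = N^(-alpha/16) and q = sqrt N, so that x^8 = N^(-alpha/2) and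
   x^4 = N^(-alpha/4). *)
Lemma count_eigenvalues_G_rate {R : realType} n (U : 'M[R[i]]_n)
    (v : 'cV[R[i]]_n) (t x q : R) :
  U \is unitarymx -> (v^t* *m v) 0 0 = 1 -> 0 < x -> x <= 1 / 128 -> 1 <= q ->
  x < q * normc ((v^t* *m U^t* *m v) 0 0) -> `|t| <= x ^+ 16 / q ->
  (forall y, normc y <= 1 / 2 ->
     normc (W2 U v y) <= x^-1 * (normc y ^+ 2 / (q * (1 - normc y)))) ->
  count (disk 0 (1 / 2 * (x ^+ 8 / (1 + x ^+ 8)))) (eigenvalues (G U v t)) = 1%N /\
  count (closed_annulus (1 / 2 * (x ^+ 4 / (1 + x ^+ 4)))) (eigenvalues (G U v t)) =
    (n - 1)%N.
Proof.
move=> uU v1 x0 x1 q1 kx tx HW; set k := normc _ in kx.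
have q0 : 0 < q by lra.
have x4 : 0 < x ^+ 4 by rewrite exprn_gt0.
have x41 : x ^+ 4 <= 1 / 128.
  by rewrite exprS (le_trans _ x1) // ler_piMr ?exprn_ile1 // ltW //; lra.
have x8E : x ^+ 8 = x ^+ 4 * x ^+ 4 by rewrite -exprD.
have x8 : x ^+ 8 <= x ^+ 4 / 128 by rewrite x8E; nra.
have x80 : 0 < x ^+ 8 by rewrite exprn_gt0.
have ratio (a : R) : 0 < a -> a <= 1 -> a / 2 <= a / (1 + a) <= a.
  move=> a0 a1; rewrite ler_pM2l // lef_pV2 ?posrE; [|lra..].
  by rewrite ler_pdivrMr; [nra | lra].
have /andP[r1l r1u] : x ^+ 8 / 2 <= x ^+ 8 / (1 + x ^+ 8) <= x ^+ 8 by apply: ratio; lra.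
have /andP[r2l r2u] : x ^+ 4 / 2 <= x ^+ 4 / (1 + x ^+ 4) <= x ^+ 4 by apply: ratio; lra.
move: r1l r1u r2l r2u; set s1 := _ / (1 + x ^+ 8); set s2 := _ / (1 + x ^+ 4) => *.
have kq : x / q < k by rewrite ltr_pdivrMr // mulrC.
have xq0 : 0 < x / q by rewrite divr_gt0.
have k0 : 0 < k by lra.
have qV : q^-1 <= 1 by rewrite invf_le1.
have x7 : x ^+ 7 <= 1 / 32.
  rewrite exprS; apply: (@le_trans _ _ (1 / 128)); last lra.
  by rewrite -[leRHS]mulr1 ler_pM ?exprn_ge0 ?exprn_ile1 //; lra.
apply: (count_eigenvalues_G U v t uU v1) => //; [lra..| | |].
- apply: le_trans tx _; apply: (@le_trans _ _ (1 / 8 * 1)); last lra.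
  rewrite ler_pM ?exprn_ge0 ?invr_ge0 // ?ltW //.
  by rewrite (_ : 16 = 8 + 8)%N // exprD; nra.
- apply: le_trans tx _.
  (* Here x/q < k, x^8 <= 2 [s1] and x^7 <= 1/32 multiply to k [s1] / 16, which is k r1 / 8 for the
     inner radius r1 = [s1] / 2. *)
  have -> : x ^+ 16 / q = (x / q) * (x ^+ 8) * (x ^+ 7).
    by rewrite (_ : 16 = 1 + 8 + 7)%N // !exprD expr1; ring.
  have h : (x / q) * (x ^+ 8) <= k * (2 * s1) by apply: ler_pM; lra.
  have h0 : 0 < (x / q) * (x ^+ 8) by apply: mulr_gt0.
  by apply: le_trans (ler_wpM2l (ltW h0) x7) _; rewrite -/k -/s1; lra.
- move=> y /andP[yl yu]; set a := normc y in yl yu *.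
  apply: le_trans (HW y _) _; first by rewrite -/a; lra.
  have a0 : 0 < a by lra.
  have d0 : 0 < 1 - a by lra.
  rewrite -/a.
  (* Again x/q < k; since a <= 8 x^4, the remaining factor a / ((1 - a) x^2) is of order x^2. *)
  have -> : x^-1 * (a ^+ 2 / (q * (1 - a))) = a * ((x / q) * (a / (1 - a) / x ^+ 2)).
    by field; rewrite !gt_eqF.
  rewrite -/k [k * a]mulrC -[leRHS]mulrA ler_pM2l //.
  have h : a / (1 - a) / x ^+ 2 <= 1 / 8.
    rewrite ler_pdivrMr ?exprn_gt0 // ler_pdivrMr //.
    have x4E : x ^+ 4 = x ^+ 2 * x ^+ 2 by rewrite -exprD.
    have x20 : 0 < x ^+ 2 by rewrite exprn_gt0.
    have x2 : x ^+ 2 <= 1 / 128 / 128 by rewrite expr2; nra.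
    nra.
  by apply: le_trans (ler_wpM2l (ltW xq0) h) _; lra.
Qed.

(* Applied with x = N^(-eps/2), p = N^(-alpha+eps) and q = sqrt N. *)
Lemma eigenvalue_G_annulus_rate {R : realType} n (U : 'M[R[i]]_n)
    (v : 'cV[R[i]]_n) (t x p q : R) z :
  U \is unitarymx -> (v^t* *m v) 0 0 = 1 -> `|t| <= 1 ->
  0 < x -> 4 * x < 1 -> 0 < p -> p <= 1 -> 0 < q ->
  q * normc ((v^t* *m U^t* *m v) 0 0) < x^-1 -> (x ^+ 2 * p * q)^-1 < `|t| ->
  (forall y, normc y < 1 - p ->
     normc (W2 U v y) <= x^-1 * (normc y ^+ 2 / (q * (1 - normc y)))) ->
  eigenvalue (G U v t) z -> z \in closed_annulus (1 - p).
Proof.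
move=> uU v1 t1 x0 x4 p0 p1 q0 kx tx HW.
apply: eigenvalue_G_annulus => //; first lra.
move=> y yp; have {}HW := HW y yp; move: kx HW yp (normc_ge0 y).
set k := normc _ ; set a := normc y; set W := normc _ => kx HW ap a0.
have a1 : a <= 1 by lra.
have k0 : 0 <= k by exact: normc_ge0.
(* b bounds both terms of h on the disk of radius 1 - p, so |1 - t| |h| <= 4b <= b/x = 1/(x^2 p q) <
   |t|. *)
pose c := (x * q)^-1; have c0 : 0 < c by rewrite invr_gt0 mulr_gt0.
pose b := c / p; have b0 : 0 < b by rewrite divr_gt0.
have kb : a * k <= b.
  have kc : k < c by rewrite /c invfM ltr_pdivlMr // mulrC.
  apply: le_trans (_ : 1 * c <= _); first by rewrite ler_pM // ltW.
  by rewrite mul1r /b ler_pdivlMr // ler_piMr // ltW.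
have Wb : W <= b.
  apply: le_trans HW _.
  have -> : x^-1 * (a ^+ 2 / (q * (1 - a))) = c * (a ^+ 2 / (1 - a)).
    by rewrite /c; field; rewrite !gt_eqF //; lra.
  rewrite /b ler_pM2l // -[leRHS]mul1r ler_pM ?exprn_ge0 ?exprn_ile1 //.
    by rewrite invr_ge0; lra.
  by rewrite lef_pV2 ?posrE //; lra.
have t2 : `|1 - t| <= 2 by apply: le_trans (ler_normB _ _) _; rewrite normr1; lra.
apply: le_lt_trans (_ : 2 * (b + b) < _).
  apply: ler_pM => //; last by rewrite lerD.
  by rewrite addr_ge0 ?mulr_ge0 ?normc_ge0.
apply: le_lt_trans tx.
have -> : (x ^+ 2 * p * q)^-1 = b / x by rewrite /b /c; field; rewrite !gt_eqF.
by rewrite ler_pdivlMr //; nra.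
Qed.

Lemma powRN_exprn {R : realType} (y a b : R) k : 0 <= y -> a = b * k%:R ->
  y `^ (- a) = (y `^ (- b)) ^+ k.
Proof. by move=> y0 ->; rewrite -mulNr powRrM powR_mulrn ?powR_ge0. Qed.

(** * Assembly: choice of exponents *)

Theorem theorem1 (R : realType) (d : nat -> measure_display)
    (T : forall N, measurableType (d N)) (P : forall N, probability (T N) R)
    (U : forall N, T N -> 'M[R[i]]_N) (v : forall N, T N -> 'cV[R[i]]_N)
    (mU : forall N, (0 < N)%N -> random_mx (U N))
    (mv : forall N, (0 < N)%N -> random_mx (v N))
    (unitaryU : forall N w, (0 < N)%N -> U N w \is unitarymx)
    (unitv : forall N w, (0 < N)%N -> ((v N w)^t* *m v N w) 0 0 = 1)
    (regW2 : W2_regular P U v)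
    (regomega1 : omega1_regular P U v)
    (alpha eps : R) (eps_gt0 : 0 < eps) (eps_lt_alpha : eps < alpha) :
  strongly_separated_at_origin P (fun N w t => G (U N w) (v N w) t)
    (fun N => [set t | -1 < t < 1 /\ `|t| < N%:R `^ (- (1 / 2) - alpha)])
  /\
  with_high_probability P (fun N => [set w | forall t : R,
    -1 < t < 1 -> N%:R `^ (- (1 / 2) + alpha) < `|t| ->
    forall z : R[i], eigenvalue (G (U N w) (v N w) t) z ->
      z \in closed_annulus (1 - N%:R `^ (- alpha + eps))]).
Proof.
have alpha0 : 0 < alpha by lra.
have sqrtNE (N : nat) (b : R) : (0 < N)%N ->
    N%:R `^ (- (1 / 2) + b) = N%:R `^ b / Num.sqrt N%:R.
  move=> N0; rewrite powRD; last by rewrite pnatr_eq0 -lt0n N0 implybT.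
  by rewrite mulrC powRN mul1r powR12_sqrt.
have sqrtN1 N : (0 < N)%N -> 1 <= Num.sqrt (N%:R : R).
  by move=> N0; rewrite -[leLHS]sqrtr1 ler_sqrt ?ltr0n // ler1n.
have W2_bound N w del e : (0 < N)%N -> (forall z, z \in disk 0 (1 - N%:R `^ (- del)) ->
      normc (W2 (U N w) (v N w) z) <= N%:R `^ e *
        normc (normc z ^+ 2 / (Num.sqrt N%:R * (1 - normc z)))%:C) ->
    forall z, normc z < 1 - N%:R `^ (- del) -> normc (W2 (U N w) (v N w) z) <=
      (N%:R `^ (- e))^-1 * (normc z ^+ 2 / (Num.sqrt N%:R * (1 - normc z))).
  move=> N0 H z zd; apply: le_trans (H z _) _.
    by rewrite -[z \in _]/(disk 0 _ z) disk0E.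
  rewrite powRN invrK normc_real ger0_norm // divr_ge0 ?exprn_ge0 ?normc_ge0 //.
  rewrite mulr_ge0 ?sqrtr_ge0 // subr_ge0 ltW //.
  by apply: lt_le_trans zd _; rewrite gerBl powR_ge0.
split.
(* All rates become powers of x = N^(-e): N^(-alpha/2), N^(-alpha/4) and N^(-alpha) are x^8, x^4 and
   x^16. Taking delta = 1 is enough, as |y| <= 1/2 stays below 1 - 1/N for large N. *)
- pose e := alpha / 16; have e0 : 0 < e by rewrite /e; lra.
  exists (- (alpha / 2)), (- (alpha / 4)), (1 / 2), (1 / 2); split; try lra.
  apply: (with_high_probabilityI _ _ _ _ _ (regomega1 e e0)
    (with_high_probability_overwhelming _ _ (regW2 1 ltr01 e e0))).
  near=> N => w [/= /andP[om _] /W2_bound HW] t [_ tS].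
  have N0 : (0 < N)%N by near: N; exact: nbhs_infty_gt.
  have x0 : 0 < (N%:R : R) `^ (- e) by rewrite powR_gt0 ?ltr0n.
  have N2 : (N%:R : R) `^ (-1) < 1 / 2.
    by near: N; apply: near_powRN_lt; lra.
  rewrite (@powRN_exprn _ _ (alpha / 2) e 8) ?ler0n //; last by rewrite /e; lra.
  rewrite (@powRN_exprn _ _ (alpha / 4) e 4) ?ler0n //; last by rewrite /e; lra.
  apply: (count_eigenvalues_G_rate _ _ _ _ _ (Num.sqrt N%:R)).
  + exact: unitaryU.
  + exact: unitv.
  + by [].
  + by apply: ltW; near: N; apply: near_powRN_lt => //; lra.
  + exact: sqrtN1.
  + by rewrite -normc_omega1.
  + rewrite -(@powRN_exprn _ _ alpha e 16) ?ler0n //; last by rewrite /e; lra.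
    by rewrite -sqrtNE // ltW.
  + by move=> y y2; apply: HW => //; lra.
(* Now x^2 = N^(-eps), and delta = alpha - eps makes the disk where [W2] is controlled the one to be
   shown free of eigenvalues. *)
- pose e := eps / 2; have e0 : 0 < e by rewrite /e; lra.
  have del0 : 0 < alpha - eps by lra.
  apply: (with_high_probabilityI _ _ _ _ _ (regomega1 e e0)
    (with_high_probability_overwhelming _ _ (regW2 (alpha - eps) del0 e e0))).
  near=> N => w [/= /andP[_ om] /W2_bound HW] t tI tS z.
  have N0 : (0 < N)%N by near: N; exact: nbhs_infty_gt.
  have x0 : 0 < (N%:R : R) `^ (- e) by rewrite powR_gt0 ?ltr0n.
  have pE : - alpha + eps = - (alpha - eps) by lra.
  have p0 : 0 < (N%:R : R) `^ (- (alpha - eps)) by rewrite powR_gt0 ?ltr0n.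
  have x4 : (N%:R : R) `^ (- e) < 1 / 4 by near: N; apply: near_powRN_lt => //; lra.
  rewrite pE.
  apply: (eigenvalue_G_annulus_rate _ _ _ t (N%:R `^ (- e)) _ (Num.sqrt N%:R)) => //.
  + exact: unitaryU.
  + exact: unitv.
  + by rewrite ler_norml; lra.
  + lra.
  + by apply: ltW; near: N; apply: near_powRN_lt => //; lra.
  + by have := sqrtN1 N N0; lra.
  + by rewrite -normc_omega1 powRN invrK.
  (* The exponents of x^2 p add up to -eps - (alpha - eps) = -alpha, so 1/(x^2 p q) is the threshold
     N^(-1/2 + alpha). *)
  + apply: le_lt_trans tS; rewrite sqrtNE // invfM ler_pM2r ?invr_gt0 //; last first.
      by have := sqrtN1 N N0; lra.
    rewrite -(@powRN_exprn _ _ eps e 2) ?ler0n //; last by rewrite /e; lra.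
    rewrite -powRD; last by rewrite pnatr_eq0 -lt0n N0 implybT.
    by rewrite -powRN; have -> : - (- eps - (alpha - eps)) = alpha by lra.
  + exact: HW.
Unshelve. all: by end_near. Qed.
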